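(* Let $n\ge 3$, let $u=(u^1,\dots,u^n)$ be coordinates on an open domain, let $k$ be a constant and $V(u)$ a potential, and consider the stationary Schrödinger equation $\Delta\psi+(k^2-V)\psi=0$, where $\Delta$ is the Laplace–Beltrami operator of the metric in question. (A) Let $R(u)\neq 0$, let $G_{(i)}$ ($i=1,\dots,n$) be functions not depending on $u^i$ and $f_i$ functions of $u^i$ only, and consider the metric $$ds^2=R^{4/(2-n)}\,G_{(1)}^{2/(n-2)}\cdots G_{(n)}^{2/(n-2)}\sum_{i=1}^n G_{(i)}^{-2}\frac{1}{f_i^2}(du^i)^2 .$$ This metric (with $V$) is $R$-separable in the Schrödinger equation if and only if there exist functions $q_i(u^i)$, each depending only on $u^i$, such that $$\sum_{i=1}^n G_{(i)}^2 f_i^2\Big[\Big(\frac1R\Big)_{,ii}+\frac{f_i'}{f_i}\Big(\frac1R\Big)_{,i}+q_i\frac1R\Big]=R^{(n+2)/(2-n)}G_{(1)}^{2/(n-2)}\cdots G_{(n)}^{2/(n-2)}\,(k^2-V).$$ (B) Let $G_{ij}=G_{ij}(u^i,u^j)$ ($1\le i<j\le n$) be functions of two variables and consider the metric $$ds^2=R^{4/(2-n)}\sum_{i=1}^n\frac{\prod_{q>i}G_{iq}^2\prod_{p<i}G_{pi}^2}{f_i^2}(du^i)^2 .$$ This metric (with $V$) is $R$-separable in the Schrödinger equation if and only if there exist functions $q_i(u^i)$ such that $$\sum_{i=1}^n\frac{f_i^2}{\prod_{q>i}G_{iq}^2\prod_{p<i}G_{pi}^2}\Big[\Big(\frac1R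\Big)_{,ii}+\frac{f_i'}{f_i}\Big(\frac1R\Big)_{,i}+q_i\frac1R\Big]=R^{(n+2)/(2-n)}(k^2-V).$$
   Context: Subscripts after a comma denote partial derivatives with respect to $u^i$. For a diagonal metric $\sum_i H_i^2(du^i)^2$ with $h=H_1\cdots H_n$, $\Delta=h^{-1}\sum_i\partial_{u^i}\big(\tfrac{h}{H_i^2}\partial_{u^i}\big)$. Definition ($R$-separability): the metric and potential $V$ are $R$-separable in $\Delta\psi+(k^2-V)\psi=0$ if there exist functions $R(u)\not\equiv0$, $p_i(u^i)$, $q_i(u^i)$ such that whenever $\varphi_i(u^i)$ satisfy $\varphi_i''+p_i\varphi_i'+q_i\varphi_i=0$ for all $i$, the function $\psi=R\prod_i\varphi_i(u^i)$ solves the equation. In (A) and (B) the $R$ of the separability is the function $R$ appearing in the metric. All functions are smooth. *)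

(* Defs.v *)
From HB Require Import structures.
From mathcomp Require Import all_boot all_order all_algebra.
From mathcomp Require Import all_classical all_reals all_analysis.
Set Implicit Arguments. Unset Strict Implicit. Unset Printing Implicit Defensive.
Import Order.TTheory GRing.Theory Num.Theory.
Import numFieldNormedType.Exports.
Local Open Scope classical_set_scope.
Local Open Scope ring_scope.

Section Defs.
Variables (R : realType) (n : nat).

Definition ucoord (i : 'I_n) (u : 'rV[R]_n) : R := u ord0 i.

Definition pd (i : 'I_n) (F : 'rV[R]_n -> R) : 'rV[R]_n -> R :=
  'D_(delta_mx 0 i : 'rV[R]_n) F.

Definition pdl (l : seq 'I_n) (F : 'rV[R]_n -> R) : 'rV[R]_n -> R :=
  foldr pd F l.

Definition smooth_on (U : set 'rV[R]_n) (F : 'rV[R]_n -> R) : Prop :=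
  forall (l : seq 'I_n) (u : 'rV[R]_n), U u -> differentiable (pdl l F) u.

Definition coord_range (U : set 'rV[R]_n) (i : 'I_n) : set R :=
  [set ucoord i u | u in U].

Definition ode_sol (S : set R) (p q phi : R -> R) : Prop :=
  forall x, S x ->
    derivable phi x 1 /\ derivable (derive1 phi) x 1 /\
    derive1 (derive1 phi) x + p x * derive1 phi x + q x * phi x = 0.

(* diagonal metric sum_i g_i (du^i)^2, H_i = sqrt g_i, h = H_1 ... H_n;
   Laplace-Beltrami operator  h^-1 sum_i d_i (h / H_i^2 d_i psi) *)
Definition Hcoef (g : 'I_n -> 'rV[R]_n -> R) (i : 'I_n) (u : 'rV[R]_n) : R :=
  Num.sqrt (g i u).
Definition hdet (g : 'I_n -> 'rV[R]_n -> R) (u : 'rV[R]_n) : R :=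
  \prod_(i < n) Hcoef g i u.
Definition laplacian (g : 'I_n -> 'rV[R]_n -> R) (psi : 'rV[R]_n -> R)
    (u : 'rV[R]_n) : R :=
  (hdet g u)^-1 *
  \sum_(i < n) pd i (fun v => hdet g v / (Hcoef g i v) ^+ 2 * pd i psi v) u.

Definition R_separable (U : set 'rV[R]_n) (g : 'I_n -> 'rV[R]_n -> R)
    (V : 'rV[R]_n -> R) (k : R) (Rf : 'rV[R]_n -> R) : Prop :=
  exists p q : 'I_n -> R -> R,
    (forall i, smooth_on U (fun u => p i (ucoord i u))) /\
    (forall i, smooth_on U (fun u => q i (ucoord i u))) /\
    forall phi : 'I_n -> R -> R,
      (forall i, ode_sol (coord_range U i) (p i) (q i) (phi i)) ->
      let psi := fun u => Rf u * \prod_(i < n) phi i (ucoord i u) in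
      forall u, U u -> laplacian g psi u + (k ^+ 2 - V u) * psi u = 0.

(* R^{4/(2-n)}, read as |R|^{4/(2-n)} *)
Definition conf_factor (Rf : 'rV[R]_n -> R) (u : 'rV[R]_n) : R :=
  `|Rf u| `^ (4 / (2 - n%:R)).

(* G_(1)^{2/(n-2)} ... G_(n)^{2/(n-2)}, read with |G_(j)| *)
Definition Gprod (G : 'I_n -> 'rV[R]_n -> R) (u : 'rV[R]_n) : R :=
  \prod_(j < n) `|G j u| `^ (2 / (n%:R - 2)).

Definition metricA (Rf : 'rV[R]_n -> R) (G : 'I_n -> 'rV[R]_n -> R)
    (f : 'I_n -> R -> R) (i : 'I_n) (u : 'rV[R]_n) : R :=
  conf_factor Rf u * Gprod G u * (G i u) ^- 2 * (f i (ucoord i u)) ^- 2.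

Definition Gpair (G : 'I_n -> 'I_n -> R -> R -> R) (i : 'I_n) (u : 'rV[R]_n) : R :=
  (\prod_(q < n | (i < q)%N) (G i q (ucoord i u) (ucoord q u)) ^+ 2) *
  (\prod_(p < n | (p < i)%N) (G p i (ucoord p u) (ucoord i u)) ^+ 2).

Definition metricB (Rf : 'rV[R]_n -> R) (G : 'I_n -> 'I_n -> R -> R -> R)
    (f : 'I_n -> R -> R) (i : 'I_n) (u : 'rV[R]_n) : R :=
  conf_factor Rf u * Gpair G i u / (f i (ucoord i u)) ^+ 2.

Definition bracket (Rf : 'rV[R]_n -> R) (f q : 'I_n -> R -> R) (i : 'I_n)
    (u : 'rV[R]_n) : R :=
  let invR := fun v => (Rf v)^-1 in
  pd i (pd i invR) u + derive1 (f i) (ucoord i u) / f i (ucoord i u) * pd i invR u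
  + q i (ucoord i u) * invR u.

End Defs.

(* Main.v *)
Require Import Defs.
From HB Require Import structures.
From mathcomp Require Import all_boot all_order all_algebra.
From mathcomp Require Import all_classical all_reals all_analysis.
From mathcomp Require Import ring lra.
Import Order.TTheory GRing.Theory Num.Theory.
Import numFieldNormedType.Exports.
Local Open Scope classical_set_scope.
Local Open Scope ring_scope.

(**
Write S = 1/R, and let F be the product of the |f_i|. Both metrics have the form
g_i = R^(4/(2-n)) B_i / f_i^2 with P := prod_i sqrt(B_i) such that P / B_i does
not depend on u^i. Then h / g_i = R^-2 (P / B_i) f_i^2 / F, and since
R^-2 d_i(R Phi) = S d_i Phi - Phi d_i S, the Schroedinger equation for
R prod_i phi_i becomes
  sum_i (P / B_i) f_i^2 [S (d_ii Phi + (f_i'/f_i) d_i Phi)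
      - Phi (d_ii S + (f_i'/f_i) d_i S)] + R^((n+2)/(2-n)) P (k^2 - V) Phi = 0.
If the stated condition holds, p_i = f_i'/f_i makes the separated equations
solve this identically. Conversely, given any admissible p_i and q_i and any
point u, the solutions with phi_i(u^i) = 1 and phi_i'(u^i) = 0 reduce the
equation at u to the condition with these same q_i. They have to be solutions on
the whole range of u^i, which is an open interval; their existence is proved by
Picard iteration.
*)

(** * Linear second-order equations on an open interval *)

Section LinearODE.
Context {R : realType}.
Implicit Types (I : set R) (F g p q : R -> R).

(** All estimates below live on a segment with the base point [x0] and the target [x] in its
    interior: openness leaves room beyond both points, convexity keeps the hull inside [I]. *)
Lemma itv_between I (x0 x : R) : open I -> is_interval I -> I x0 -> I x ->
  exists a b : R, [/\ a < x0 < b, a < x < b & `[a, b] `<=` I].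
Proof.
move=> oI iI Ix0 Ix.
have aux y : I y -> exists e : R, [/\ 0 < e, I (y - e) & I (y + e)].
  move=> Iy; have /nbhs_ballP[e /= e0 be] : nbhs y I by exact: open_nbhs_nbhs.
  exists (e / 2); split; first by rewrite divr_gt0.
  - apply: be; rewrite /ball /= opprB addrC subrK gtr0_norm ?divr_gt0//.
    by rewrite ltr_pdivrMr// mulr_natr mulr2n ltrDl.
  - apply: be; rewrite /ball /= opprD addrA subrr sub0r normrN gtr0_norm ?divr_gt0//.
    by rewrite ltr_pdivrMr// mulr_natr mulr2n ltrDl.
have [e [e0 Il Ir]] := aux _ Ix0.
have [d [d0 Jl Jr]] := aux _ Ix.
exists (Num.min (x0 - e) (x - d)), (Num.max (x0 + e) (x + d)); split.
- by rewrite gt_min lt_max; apply/andP; split; apply/orP; left; lra.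
- by rewrite gt_min lt_max; apply/andP; split; apply/orP; right; lra.
- move=> t /=; rewrite in_itv /= => tab.
  have I1 : I (Num.min (x0 - e) (x - d)) by case: leP.
  have I2 : I (Num.max (x0 + e) (x + d)) by case: leP.
  exact: iI I1 I2 _ tab.
Qed.

Lemma is_derive_ge0_le (F dF : R -> R) (a b : R) : a <= b ->
  (forall t, a <= t <= b -> is_derive t (1 : R) F (dF t)) ->
  (forall t, a <= t <= b -> 0 <= dF t) -> F a <= F b.
Proof.
move=> ab dFt dF0.
have [||c cab FE] := @MVT_segment R F dF a b ab.
- by move=> t /[!in_itv]/= /andP[at_ tb]; apply: dFt; rewrite !ltW.
- apply: derivable_within_continuous => t /[!in_itv]/= tab.
  by have := dFt _ tab; case.
- rewrite -subr_ge0 FE mulr_ge0 ?subr_ge0//; apply: dF0.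
  by rewrite in_itv /= in cab.
Qed.

(* The weight exp(2K|x - x0|) makes the Picard map a contraction with ratio 1/2
   on every compact interval. *)
Lemma is_derive_expR_bound (F dF : R -> R) (x0 x K c : R) : 0 < K -> 0 <= c ->
  (forall t, Num.min x0 x <= t <= Num.max x0 x -> is_derive t (1 : R) F (dF t)) ->
  F x0 = 0 ->
  (forall t, Num.min x0 x <= t <= Num.max x0 x ->
     `|dF t| <= K * (c * expR (2 * K * `|t - x0|))) ->
  `|F x| <= c / 2 * expR (2 * K * `|x - x0|).
Proof.
move=> K0 c0 dFt F0 dFb.
(* For s = 2K this comparison function has derivative K c exp(2K(t - x0)), exactly the bound assumed
   on [dF]; s = -2K serves to the left of [x0]. *)
have dE (s t : R) :
    is_derive t (1 : R) (fun t => c / 2 * expR (s * (t - x0)))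
      (s * c / 2 * expR (s * (t - x0))).
  have dl : is_derive t (1 : R) (fun t => s * (t - x0)) s.
    apply: is_derive_eq; rewrite /GRing.scale /=; ring.
  have de := @is_derive1_comp _ expR (fun t => s * (t - x0)) t _ _ (is_derive_expR _) dl.
  apply: is_derive_eq; rewrite /GRing.scale /=; ring.
suff main (sg : bool) :
    0 <= c / 2 * expR (2 * K * `|x - x0|) + (-1) ^+ sg * F x.
  rewrite ler_norml; have := main true; have := main false.
  rewrite expr0 expr1; lra.
have dEF (s t : R) : Num.min x0 x <= t <= Num.max x0 x ->
    is_derive t (1 : R) (fun t => c / 2 * expR (s * (t - x0)) + (-1) ^+ sg * F t)
      (s * c / 2 * expR (s * (t - x0)) + (-1) ^+ sg * dF t).
  move=> ht; have := dFt _ ht => ?; have := dE s t => ?.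
  apply: is_derive_eq; rewrite /GRing.scale /=; ring.
have sgb t : - `|dF t| <= (-1) ^+ sg * dF t <= `|dF t|.
  by rewrite -ler_norml normrM normrX normrN1 expr1n mul1r.
case: (leP x0 x) => [xx|xx] in dFt dFb dEF *.
- rewrite ger0_norm ?subr_ge0//.
  have := @is_derive_ge0_le _ _ x0 x xx (fun t ht => dEF (2 * K) t ht).
  rewrite subrr mulr0 expR0 F0 mulr0 addr0 => H.
  apply: le_trans (H _); first by rewrite mulr1 divr_ge0.
  move=> t /[dup] ht /andP[t0 _].
  have := dFb _ ht; rewrite [`|t - x0|]ger0_norm ?subr_ge0//.
  have := sgb t => /andP[s1 s2]; lra.
- rewrite ltr0_norm ?subr_lt0//.
  have H : c / 2 <= c / 2 * expR (- (2 * K) * (x - x0)) + (-1) ^+ sg * F x.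
    (* To the left of [x0] the comparison sum decreases, so its negative is used. *)
    pose E t := - (c / 2 * expR (- (2 * K) * (t - x0)) + (-1) ^+ sg * F t).
    have : E x <= E x0.
      pose dE' t := - (- (2 * K) * c / 2 * expR (- (2 * K) * (t - x0)) + (-1) ^+ sg * dF t).
      apply: (@is_derive_ge0_le E dE' x x0 (ltW xx)).
        by move=> t ht; have := dEF (- (2 * K)) t ht => ?; apply: is_derive_eq.
      move=> t /[dup] ht /andP[_ t0].
      have := dFb _ ht; rewrite [`|t - x0|]ler0_norm ?subr_le0//.
      have -> : 2 * K * - (t - x0) = - (2 * K) * (t - x0) by ring.
      rewrite /dE'; have := sgb t => /andP[s1 s2]; lra.
    by rewrite /E subrr mulr0 expR0 F0; lra.
  have -> : 2 * K * - (x - x0) = - (2 * K) * (x - x0) by ring.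
  by apply: le_trans H; rewrite divr_ge0.
Qed.

(** The exponential bound with c = 0 and K = 1, applied to F - F x0. *)
Lemma is_derive_eq0_const I F (x0 x : R) : is_interval I -> I x0 -> I x ->
  (forall t, I t -> is_derive t (1 : R) F 0) -> F x = F x0.
Proof.
move=> iI Ix0 Ix dF; apply/eqP; rewrite -subr_eq0 -normr_le0.
have J t : Num.min x0 x <= t <= Num.max x0 x -> I t.
  by case: (leP x0 x) => _ ht; [exact: iI Ix0 Ix _ ht|exact: iI Ix Ix0 _ ht].
have := @is_derive_expR_bound (fun t => F t - F x0) (fun=> 0) x0 x 1 0 ltr01 (lexx _).
rewrite !mul0r; apply.
- move=> t /J /dF ?; apply: is_derive_eq; rewrite subr0//.
- exact: subrr.
- by move=> t _; rewrite normr0 mul0r mulr0.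
Qed.

Lemma antiderivative_itv g (a b x0 : R) : a < x0 < b ->
  (forall x, a <= x <= b -> {for x, continuous g}) ->
  exists2 F, F x0 = 0 & forall x, a < x < b -> is_derive x (1 : R) F (g x).
Proof.
move=> /andP[ax0 x0b] cg; have ab := lt_trans ax0 x0b.
have ig : lebesgue_measure.-integrable `[a, b] (EFin \o g).
  apply: continuous_compact_integrable; first exact: segment_compact.
  apply/continuous_within_itvP => //; split.
  - by move=> t /[!in_itv]/= /andP[at_ tb]; apply: cg; rewrite !ltW.
  - apply: cvg_at_right_filter; apply: cg; rewrite lexx ltW//.
  - apply: cvg_at_left_filter; apply: cg; rewrite lexx ltW//.
pose F x := (\int[lebesgue_measure]_(t in [set` `[a, x]]) (g t))%R.
exists (fun x => F x - F x0); first exact: subrr.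
move=> x /andP[ax xb].
have [] := @continuous_FTC1_closed R g a x b xb ig ax.
  by apply: cg; rewrite !ltW.
rewrite -/F => dF; rewrite derive1E => FE.
have ? : is_derive x (1 : R) F (g x) by split.
apply: is_derive_eq; rewrite subr0//.
Qed.

(** The fundamental theorem of calculus acts on segments, so local antiderivatives vanishing at [x0]
    are glued. Two of them agree on their overlap, because their difference has zero derivative
    there. *)
Lemma antiderivative I g (x0 : R) : open I -> is_interval I -> I x0 ->
  (forall x, I x -> {for x, continuous g}) ->
  exists2 F, F x0 = 0 & forall x, I x -> is_derive x (1 : R) F (g x).
Proof.
move=> oI iI Ix0 cg.
pose loc (a b : R) F := [/\ a < x0 < b, `[a, b] `<=` I, F x0 = 0 &
  forall x, a < x < b -> is_derive x (1 : R) F (g x)].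
(* The values at [x] of all local antiderivatives: a singleton on [I] by [An] and [Au], empty
   elsewhere, where [xget] falls back to 0. *)
pose A x := [set v | exists a b F, [/\ a < x < b, loc a b F & F x = v]].
have An x : I x -> exists a b F, a < x < b /\ loc a b F.
  move=> Ix; have [a [b [h0 h sub]]] := itv_between _ _ _ oI iI Ix0 Ix.
  have [|F F0 dF] := @antiderivative_itv g a b x0 h0.
    by move=> t ht; apply: cg; apply: sub => /=; rewrite in_itv.
  by exists a, b, F.
have Au x (v w : R) : A x v -> A x w -> v = w.
  move=> [a [b [F [h [h0 sub F0 dF] <-]]]] [a' [b' [G [h' [h0' sub' G0 dG] <-]]]].
  apply/eqP; rewrite -subr_eq0; apply/eqP.
  pose J := [set t : R | (a < t < b) && (a' < t < b')].
  have -> : 0 = F x0 - G x0 by rewrite F0 G0 subrr.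
  apply: (@is_derive_eq0_const J (fun t => F t - G t)).
  - move=> s t /andP[/andP[? ?] /andP[? ?]] /andP[/andP[? ?] /andP[? ?]] r.
    by move=> /andP[? ?]; apply/andP; split; apply/andP; split; lra.
  - by rewrite /J /= h0 h0'.
  - by rewrite /J /= h h'.
  - move=> t /andP[/dF ? /dG ?]; apply: is_derive_eq; exact: subrr.
have AE a b F : loc a b F -> forall t, a < t < b -> xget 0 (A t) = F t.
  move=> lF t ht; apply: (Au t); last by exists a, b, F.
  by apply: xgetPex; exists (F t), a, b, F.
exists (fun x => xget 0 (A x)) => [|x Ix].
  have [a [b [F [h lF]]]] := An _ Ix0.
  by rewrite (AE _ _ _ lF _ h); case: lF.
have [a [b [F [h lF]]]] := An _ Ix.
apply: (@near_eq_is_derive _ _ _ F); last by case: lF => _ _ _; apply.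
near=> t; apply/esym; apply: (AE _ _ _ lF).
have : t \in `]a, b[ by near: t; apply: near_in_itvoo; rewrite in_itv.
by rewrite in_itv.
Unshelve. all: by end_near. Qed.

(** The tail of the series of C 2^-j from j = m on is 2C 2^-m. Hence the intervals of this radius
    about the [u m] are nested, and the supremum of their left ends lies in all of them. *)
Lemma geometric_cauchy_limit (u : nat -> R) (C : R) :
  (forall m, `|u m.+1 - u m| <= C * 2^-1 ^+ m) ->
  exists l, forall m, `|u m - l| <= 2 * C * 2^-1 ^+ m.
Proof.
move=> hu.
pose a m := u m - 2 * C * 2^-1 ^+ m; pose b m := u m + 2 * C * 2^-1 ^+ m.
have aS m : a m <= a m.+1.
  have := hu m; rewrite ler_norml /a exprS => /andP[]; lra.
have bS m : b m.+1 <= b m.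
  have := hu m; rewrite ler_norml /b exprS => /andP[]; lra.
have C0 m : 0 <= C * 2^-1 ^+ m := le_trans (normr_ge0 _) (hu m).
have ab m : a m <= b m by rewrite /a /b; have := C0 m; lra.
have hab i j : a i <= b j.
  have ha : forall m d, a m <= a (m + d)%N.
    by move=> m; elim=> [|d IH]; rewrite ?addn0 ?addnS// (le_trans IH).
  have hb : forall m d, b (m + d)%N <= b m.
    by move=> m; elim=> [|d IH]; rewrite ?addn0 ?addnS// (le_trans _ IH).
  by apply: le_trans (ha i j) _; apply: le_trans (ab _) _; rewrite addnC.
have sa : has_sup (range a).
  split; first by exists (a 0%N), 0%N.
  by exists (b 0%N) => _ [m _ <-].
exists (sup (range a)) => m.
have h1 : a m <= sup (range a) by apply: sup_upper_bound => //; exists m.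
have h2 : sup (range a) <= b m.
  by apply: ge_sup; [exact: sa.1|move=> _ [j _ <-]].
rewrite ler_norml; move: h1 h2; rewrite /a /b; lra.
Qed.

Lemma geometric_bound_cvg (u : nat -> R) (l C : R) :
  (forall m, `|u m - l| <= C * 2^-1 ^+ m) -> u @ \oo --> l.
Proof.
move=> hu; apply/cvgrPdist_le => e e0.
have h : C * 2^-1 ^+ m @[m --> \oo] --> 0.
  rewrite -[X in _ --> X](mulr0 C); apply: cvgMr; apply: cvg_expr.
  by rewrite gtr0_norm ?invr_gt0// invf_lt1// ltr1n.
move/cvgrPdist_le : h => /(_ e e0); apply: filterS => m.
rewrite sub0r normrN => h; rewrite distrC.
by rewrite (le_trans (hu m))// (le_trans _ h)// ler_norm.
Qed.

Lemma continuous_segment_bound g (a b : R) :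
  (forall x, a <= x <= b -> {for x, continuous g}) ->
  exists2 M, 0 <= M & forall t, a <= t <= b -> `|g t| <= M.
Proof.
move=> cg; have [ab|ba] := leP a b; last first.
  by exists 0 => // t /andP[at_ tb]; have := le_trans at_ tb; rewrite leNgt ba.
have [|c _ cmax] := @EVT_max R (fun t => `|g t|) a b ab.
  apply: (@continuous_in_subspaceT _ _ `[a, b] (fun t => `|g t|)) => t.
  rewrite inE /= in_itv /= => tab.
  by apply: continuous_comp; [exact: cg|exact: norm_continuous].
exists `|g c| => // t tab; exact: (cmax t).
Qed.

(** The e/3 argument: one index [m] serves all points of the interval because the rate is uniform
    there. *)
Lemma uniform_geometric_limit_continuous (u : nat -> R -> R) (y : R -> R) (a b x C : R) :
  a < x < b -> (forall m, {for x, continuous (u m)}) ->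
  (forall m t, a < t < b -> `|u m t - y t| <= C * 2^-1 ^+ m) ->
  {for x, continuous y}.
Proof.
move=> xab cu hu; apply/cvgrPdist_lt => e e0.
have C0 : 0 <= C by have := le_trans (normr_ge0 _) (hu 0%N x xab); rewrite expr0 mulr1.
have [m hm] : exists m, C * 2^-1 ^+ m < e / 3.
  have h : C * 2^-1 ^+ m @[m --> \oo] --> 0.
    rewrite -[X in _ --> X](mulr0 C); apply: cvgMr; apply: cvg_expr.
    by rewrite gtr0_norm ?invr_gt0// invf_lt1// ltr1n.
  move/cvgrPdist_lt : h => /(_ (e / 3)); rewrite divr_gt0// => /(_ isT).
  case=> m _ /(_ m (leqnn m)) /=; rewrite sub0r normrN => h.
  by exists m; rewrite (le_lt_trans _ h)// ler_norm.
have /cvgrPdist_lt/(_ (e / 3)) := cu m; rewrite divr_gt0// => /(_ isT) cm.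
near=> t.
have tab : a < t < b.
  have : t \in `]a, b[ by near: t; apply: near_in_itvoo; rewrite in_itv.
  by rewrite in_itv.
have h1 := hu m x xab; have h2 := hu m t tab.
have h3 : `|u m x - u m t| < e / 3 by near: t.
have -> : y x - y t = - (u m x - y x) + (u m x - u m t) + (u m t - y t) by ring.
rewrite (le_lt_trans (ler_normD _ _))//.
have := ler_normD (- (u m x - y x)) (u m x - u m t); rewrite normrN; lra.
Unshelve. all: by end_near. Qed.

(** Picard iteration for the system y' = z, z' = -q y - p z. The iterates are defined on all of [I]
    at once; convergence is estimated segment by segment, with constants depending on the
    segment. *)
Lemma linear_ode_exists I p q (x0 : R) : open I -> is_interval I -> I x0 ->
  (forall x, I x -> {for x, continuous p}) ->
  (forall x, I x -> {for x, continuous q}) ->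
  exists y z : R -> R, [/\ y x0 = 1, z x0 = 0,
    forall x, I x -> is_derive x (1 : R) y (z x) &
    forall x, I x -> is_derive x (1 : R) z (- q x * y x - p x * z x)].
Proof.
move=> oI iI Ix0 cp cq.
pose cont g := forall x, I x -> {for x, continuous g}.
(* A chosen operator of antiderivatives vanishing at [x0]; on functions not continuous on [I] its
   value is irrelevant. *)
have [A hA] : exists A : (R -> R) -> R -> R, forall g, cont g ->
    A g x0 = 0 /\ forall x, I x -> is_derive x (1 : R) (A g) (g x).
  have /choice : forall g, exists F, cont g ->
      F x0 = 0 /\ forall x, I x -> is_derive x (1 : R) F (g x).
    move=> g; have [cg|ncg] := pselect (cont g); last by exists (cst 0).
    by have [F F0 dF] := antiderivative I g x0 oI iI Ix0 cg; exists F.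
  by case=> A hA; exists A.
have dcont (F dF : R -> R) : (forall x, I x -> is_derive x (1 : R) F (dF x)) -> cont F.
  move=> h x Ix; apply: differentiable_continuous; apply/derivable1_diffP.
  by have := h x Ix; case.
pose rhs (w : (R -> R) * (R -> R)) x := - q x * w.1 x - p x * w.2 x.
pose step (w : (R -> R) * (R -> R)) : (R -> R) * (R -> R) :=
  (fun x => 1 + A w.2 x, A (rhs w)).
pose cont2 (w : (R -> R) * (R -> R)) := cont w.1 /\ cont w.2.
have crhs w : cont2 w -> cont (rhs w).
  move=> [c1 c2] x Ix; apply: (@continuousB _ _ _ (fun x => - q x * w.1 x) (fun x => p x * w.2 x)).
    apply: (@continuousM _ _ (fun x => - q x) w.1); last exact: c1.
    by apply: (@continuousN _ _ _ q); exact: cq.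
  by apply: (@continuousM _ _ p w.2); [exact: cp|exact: c2].
have dstep1 w : cont2 w -> forall x, I x -> is_derive x (1 : R) (step w).1 (w.2 x).
  move=> [c1 c2] x Ix; have [_ /(_ x Ix) dA] := hA _ c2.
  rewrite /step /= -[w.2 x]add0r.
  exact: (@is_deriveD R R R (cst 1) (A w.2) x 1 0 (w.2 x) _ dA).
have dstep2 w : cont2 w -> forall x, I x -> is_derive x (1 : R) (step w).2 (rhs w x).
  by move=> cw x Ix; have [_ /(_ x Ix)] := hA _ (crhs _ cw).
have cstep w : cont2 w -> cont2 (step w).
  by move=> cw; split; [exact: dcont (dstep1 _ cw)|exact: dcont (dstep2 _ cw)].
pose e (K t : R) := expR (2 * K * `|t - x0|).
(* Distance at most [c], in both components, for the supremum norm weighted by 1 / e K t. *)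
pose close (a b K c : R) (w w' : (R -> R) * (R -> R)) := forall t, a <= t <= b ->
  `|w.1 t - w'.1 t| <= c * e K t /\ `|w.2 t - w'.2 t| <= c * e K t.
(* Integration divides the weighted norm by 2K, while [rhs] multiplies it by at most |p| + |q| <= K.
   The condition 1 <= K covers the first component, whose derivative is the second component
   itself. *)
have contr a b K c w w' : a < x0 < b -> `[a, b] `<=` I -> 1 <= K ->
    (forall t, a <= t <= b -> `|p t| + `|q t| <= K) -> 0 <= c ->
    cont2 w -> cont2 w' -> close a b K c w w' -> close a b K (c / 2) (step w) (step w').
  move=> x0ab sub K1 hK c0 cw cw' hc t tab.
  have tb s : Num.min x0 t <= s <= Num.max x0 t -> a <= s <= b.
    by move: x0ab tab => /andP[? ?] /andP[? ?]; case: (leP x0 t) => ? /andP[? ?]; lra.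
  have Is s : Num.min x0 t <= s <= Num.max x0 t -> I s.
    by move=> /tb ht; apply: sub; rewrite /= in_itv.
  have K0 : 0 < K by lra.
  have e0 s : 0 <= e K s by exact: expR_ge0.
  split.
  - apply: (@is_derive_expR_bound (fun s => (step w).1 s - (step w').1 s)
      (fun s => w.2 s - w'.2 s)) => //.
    + move=> s /Is Ix; have := dstep1 _ cw s Ix => ?; have := dstep1 _ cw' s Ix => ?.
      exact: is_derive_eq.
    + by have [h _] := hA _ cw.2; have [h' _] := hA _ cw'.2; rewrite /= h h' subrr.
    + move=> s /tb /hc[_ h]; rewrite (le_trans h)// -/(e K s).
      by rewrite ler_peMl// mulr_ge0.
  - apply: (@is_derive_expR_bound (fun s => (step w).2 s - (step w').2 s)
      (fun s => rhs w s - rhs w' s)) => //.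
    + move=> s /Is Ix; have := dstep2 _ cw s Ix => ?; have := dstep2 _ cw' s Ix => ?.
      exact: is_derive_eq.
    + have [h _] := hA _ (crhs _ cw); have [h' _] := hA _ (crhs _ cw').
      by rewrite /= h h' subrr.
    + move=> s /tb sab; have [h1 h2] := hc s sab; have hs := hK s sab.
      rewrite -/(e K s).
      have -> : rhs w s - rhs w' s = - q s * (w.1 s - w'.1 s) - p s * (w.2 s - w'.2 s).
        by rewrite /rhs; ring.
      rewrite (le_trans (ler_normB _ _))// !normrM normrN.
      have ce : 0 <= c * e K s by rewrite mulr_ge0.
      apply: (@le_trans _ _ ((`|p s| + `|q s|) * (c * e K s))); last exact: ler_wpM2r.
      by rewrite mulrDl addrC lerD// ler_wpM2l.
pose w m := iter m step (cst 1, cst 0).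
have cw m : cont2 (w m).
  elim: m => [|m IH]; last exact: cstep.
  by split=> x _; exact: cst_continuous.
pose y : (R -> R) * (R -> R) :=
  (fun x => lim ((w m).1 x @[m --> \oo]), fun x => lim ((w m).2 x @[m --> \oo])).
have loc x : I x -> exists a b K M : R, [/\ a < x0 < b, a < x < b, `[a, b] `<=` I,
    1 <= K /\ (forall t, a <= t <= b -> `|p t| + `|q t| <= K) & 0 <= M /\
    forall m, close a b K (2 * M * 2^-1 ^+ m) (w m) y].
  move=> Ix; have [a [b [x0ab xab sub]]] := itv_between _ _ _ oI iI Ix0 Ix.
  have bd g : cont g -> exists2 M, 0 <= M & forall t, a <= t <= b -> `|g t| <= M.
    move=> cg; apply: continuous_segment_bound => t tab.
    by apply: cg; apply: sub; rewrite /= in_itv.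
  have [Mp Mp0 hp] := bd _ cp; have [Mq Mq0 hq] := bd _ cq.
  have [|M1 M10 h1] := bd (fun t => (w 1%N).1 t - (w 0%N).1 t).
    by move=> t It; apply: (@continuousB _ _ _ (w 1%N).1 (w 0%N).1); [exact: (cw 1%N).1|exact: (cw 0%N).1].
  have [|M2 M20 h2] := bd (fun t => (w 1%N).2 t - (w 0%N).2 t).
    by move=> t It; apply: (@continuousB _ _ _ (w 1%N).2 (w 0%N).2); [exact: (cw 1%N).2|exact: (cw 0%N).2].
  (* [K] dominates 1 and |p| + |q| on the segment, [M] the first Picard step. *)
  pose K := 1 + Mp + Mq; pose M := M1 + M2.
  have K1 : 1 <= K by rewrite /K; lra.
  have hK t : a <= t <= b -> `|p t| + `|q t| <= K.
    by move=> tab; have := hp t tab; have := hq t tab; rewrite /K; lra.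
  have M0 : 0 <= M by rewrite /M addr_ge0.
  exists a, b, K, M; split => //; split => //.
  have hS m : close a b K (M * 2^-1 ^+ m) (w m.+1) (w m).
    elim: m => [|m IH].
      move=> t tab; rewrite expr0 mulr1.
      have e1 : 1 <= e K t by rewrite /e -[1]expR0 ler_expR !mulr_ge0//; lra.
      have MM : M <= M * e K t by rewrite ler_peMr.
      by split; apply: le_trans MM; [have := h1 t tab|have := h2 t tab]; rewrite /M; lra.
    have -> : M * 2^-1 ^+ m.+1 = (M * 2^-1 ^+ m) / 2 by rewrite exprS; ring.
    by apply: (contr _ _ _ _ (w m.+1) (w m)) => //; rewrite ?mulr_ge0 ?exprn_ge0//.
  move=> m t tab; split.
  - have [|l hl] := geometric_cauchy_limit (fun m => (w m).1 t) (M * e K t).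
      by move=> j; have [h _] := hS j t tab; rewrite mulrAC.
    have -> : y.1 t = l.
      by apply/cvg_lim => //; exact: geometric_bound_cvg hl.
    by apply: le_trans (hl m) _; rewrite le_eqVlt; apply/orP; left; apply/eqP; ring.
  - have [|l hl] := geometric_cauchy_limit (fun m => (w m).2 t) (M * e K t).
      by move=> j; have [_ h] := hS j t tab; rewrite mulrAC.
    have -> : y.2 t = l.
      by apply/cvg_lim => //; exact: geometric_bound_cvg hl.
    by apply: le_trans (hl m) _; rewrite le_eqVlt; apply/orP; left; apply/eqP; ring.
have cy : cont2 y.
  (* On ]a, b[ the weight is at most exp(2K(b - a)), which makes the weighted rate uniform. *)
  have unif a b K M m t : 1 <= K -> 0 <= M -> a < x0 < b -> a < t < b ->
      2 * M * 2^-1 ^+ m * e K t <= 2 * M * expR (2 * K * (b - a)) * 2^-1 ^+ m.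
    move=> K1 M0 /andP[? ?] /andP[? ?]; rewrite mulrAC ler_wpM2r ?exprn_ge0//.
    rewrite ler_wpM2l ?mulr_ge0// ler_expR ler_wpM2l//; first by lra.
    by rewrite ler_norml; lra.
  split=> x /loc[a [b [K [M [x0ab xab sub [K1 _] [M0 hc]]]]]].
  - apply: (@uniform_geometric_limit_continuous (fun m => (w m).1) _ a b x
      (2 * M * expR (2 * K * (b - a)))) => // [m|m t tab].
      apply: (cw m).1; apply: sub => /=; rewrite in_itv/=.
      by case/andP: xab => *; rewrite !ltW.
    have [|h _] := hc m t; first by case/andP: tab => *; rewrite !ltW.
    by apply: le_trans h _; exact: unif.
  - apply: (@uniform_geometric_limit_continuous (fun m => (w m).2) _ a b x
      (2 * M * expR (2 * K * (b - a)))) => // [m|m t tab].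
      apply: (cw m).2; apply: sub => /=; rewrite in_itv/=.
      by case/andP: xab => *; rewrite !ltW.
    have [|_ h] := hc m t; first by case/andP: tab => *; rewrite !ltW.
    by apply: le_trans h _; exact: unif.
(* The iterates tend to [y], and by the contraction applied to [w m] and [y] also to [step y];
   limits are unique. *)
have fixy x : I x -> (step y).1 x = y.1 x /\ (step y).2 x = y.2 x.
  move=> /loc[a [b [K [M [x0ab xab sub [K1 hK] [M0 hc]]]]]].
  have hx : a <= x <= b by case/andP: xab => *; rewrite !ltW.
  have hs m : close a b K (2 * M * 2^-1 ^+ m / 2) (w m.+1) (step y).
    apply: contr => //; first by rewrite !mulr_ge0// exprn_ge0.
  have uniq_ (u : nat -> R) (l l' C C' : R) :
      (forall m, `|u m - l| <= C * 2^-1 ^+ m) ->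
      (forall m, `|u m.+1 - l'| <= C' * 2^-1 ^+ m) -> l' = l.
    move=> /geometric_bound_cvg h1 /(geometric_bound_cvg (fun m => u m.+1)) h2.
    have h3 : u m.+1 @[m --> \oo] --> l by rewrite (cvg_shiftS u).
    exact: (cvg_unique _ h2 h3).
  split.
  - apply: (@uniq_ (fun m => (w m).1 x) _ _ (2 * M * e K x) (M * e K x)) => m.
      by rewrite mulrAC; have [] := hc m x hx.
    have [h _] := hs m x hx; apply: le_trans h _.
    by rewrite le_eqVlt; apply/orP; left; apply/eqP; field.
  - apply: (@uniq_ (fun m => (w m).2 x) _ _ (2 * M * e K x) (M * e K x)) => m.
      by rewrite mulrAC; have [] := hc m x hx.
    have [_ h] := hs m x hx; apply: le_trans h _.
    by rewrite le_eqVlt; apply/orP; left; apply/eqP; field.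
(* The witness is [step y] rather than [y]: its derivatives come directly from [A], and [fixy] then
   rewrites only their values. *)
exists (step y).1, (step y).2; split.
- by rewrite /=; have [-> _] := hA _ cy.2; rewrite addr0.
- by rewrite /=; have [-> _] := hA _ (crhs _ cy).
- by move=> x Ix; have [_ ->] := fixy x Ix; exact: dstep1.
- by move=> x Ix; have [-> ->] := fixy x Ix; exact: dstep2.
Qed.

End LinearODE.

(** * Coordinate derivatives and smooth functions *)

(** Differentiability depends only on the germ: the first-order expansion of [f] at [x] is one of
    [g]. This lets smoothness pass between functions that agree only on [U]. *)
Lemma near_eq_differentiable {K : numFieldType} {V W : normedModType K}
    (f g : V -> W) (x : V) :
  (\forall y \near x, f y = g y) -> differentiable f x -> differentiable g x.
Proof.
move=> fg /diff_locallyP[cdf /eqaddoP df].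
have H : g \o shift x = cst (g x) + 'd f x +o_ 0 id.
  apply/eqaddoP => eps eps0; have := df eps eps0.
  have fgx := nbhs_singleton fg.
  have fg0 : \forall h \near (0 : V), f (h + x) = g (h + x).
    by move: fg; rewrite (near_shift 0); apply: filterS => h /=; rewrite subr0.
  apply: filterS2 fg0 => h fgh.
  by rewrite /= !fctE /= fgh fgx.
apply/diff_locallyP.
by rewrite (diff_unique cdf H); split => //; rewrite (diff_unique cdf H).
Qed.

Section Coordinates.
Context {R : realType} {n : nat}.
Implicit Types (i j : 'I_n) (u v : 'rV[R]_n) (F G : 'rV[R]_n -> R) (U : set 'rV[R]_n).

Local Notation e i := (delta_mx 0 i : 'rV[R]_n).

Lemma ucoord_line i j (h : R) u :
  ucoord j (h *: e i + u) = (if j == i then h else 0) + ucoord j u.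
Proof. by rewrite /ucoord !mxE eqxx /=; case: eqP => _; rewrite ?mulr1 ?mulr0. Qed.

(** Since the difference quotients coincide as functions of h, derivability and derivative transfer
    with no regularity of [phi] assumed. *)
Lemma derive_quotient_ucoord i (phi : R -> R) u :
  (fun h : R => h^-1 *: (((fun v => phi (ucoord i v)) \o shift u) (h *: e i)
                          - phi (ucoord i u))) =
  (fun h : R => h^-1 *: ((phi \o shift (ucoord i u)) (h *: (1 : R))
                          - phi (ucoord i u))).
Proof.
apply/funext => h /=; rewrite ucoord_line eqxx.
by rewrite /GRing.scale /= mulr1.
Qed.

Lemma derivable_ucoord i (phi : R -> R) u :
  derivable (fun v => phi (ucoord i v)) u (e i) = derivable phi (ucoord i u) 1.
Proof. by rewrite /derivable derive_quotient_ucoord. Qed.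

Lemma pd_ucoord i (phi : R -> R) u :
  pd i (fun v => phi (ucoord i v)) u = derive1 phi (ucoord i u).
Proof. by rewrite derive1E /pd /derive derive_quotient_ucoord. Qed.

Lemma is_derive_ucoord i (phi : R -> R) u : derivable phi (ucoord i u) 1 ->
  is_derive u (e i) (fun v => phi (ucoord i v)) (derive1 phi (ucoord i u)).
Proof.
by move=> dphi; split; [rewrite derivable_ucoord|exact: pd_ucoord].
Qed.

Lemma is_derive_line_const i F u :
  (forall h : R, F (h *: e i + u) = F u) -> is_derive u (e i) F 0.
Proof.
move=> FE.
have H : (fun h : R => h^-1 *: ((F \o shift u) (h *: e i) - F u)) = cst 0.
  by apply/funext => h /=; rewrite FE subrr scaler0.
split; first by rewrite /derivable H; exact: is_cvg_cst.
by rewrite /derive H; exact: lim_cst.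
Qed.

Lemma ucoord_continuous i : continuous (@ucoord R n i).
Proof. exact: coord_continuous. Qed.

Lemma coord_range_open U i : open U -> open (coord_range U i).
Proof.
move=> oU; rewrite openE => _ [u Uu <-].
(* The line through [u] along the i-th axis, parametrised by its i-th coordinate. *)
pose g (y : R) : 'rV[R]_n := (y - ucoord i u) *: e i + u.
have cg : {for ucoord i u, continuous g}.
  apply: (@continuousD _ _ _ (fun y : R => (y - ucoord i u) *: e i) (cst u)).
    apply: (@continuousZr_tmp _ _ _ (fun y : R => y - ucoord i u) (e i)).
    by apply: (@continuousB _ _ _ id (cst (ucoord i u))); [exact: cvg_id|exact: cst_continuous].
  exact: cst_continuous.
have gu : g (ucoord i u) = u by rewrite /g subrr scale0r add0r.
have : nbhs (g (ucoord i u)) U by rewrite gu; exact: open_nbhs_nbhs.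
move=> h; have h2 : \forall y \near ucoord i u, U (g y) by exact: cg.
rewrite /interior /=; apply: filterS h2 => y Uy; exists (g y) => //.
by rewrite ucoord_line eqxx subrK.
Qed.

Lemma coord_range_interval U i : connected U -> is_interval (coord_range U i).
Proof.
move=> cU; apply/connected_intervalP; apply: connected_continuous_connected => //.
by apply: continuous_subspaceT; exact: ucoord_continuous.
Qed.

(** Smoothness graded by order: the partial derivatives of order at most [k] are differentiable. The
    grading allows induction on [k] in the product and inverse rules. *)
Fixpoint ck_on (k : nat) U F : Prop :=
  (forall u, U u -> differentiable F u) /\
  if k is k'.+1 then forall i, ck_on k' U (pd i F) else True.

Lemma smooth_onP U F : smooth_on U F <-> forall k, ck_on k U F.
Proof.
split=> [sF k|cF].
  elim: k F sF => [|k IH] F sF; first by split=> // u Uu; exact: (sF [::]).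
  split=> [u Uu|i]; first exact: (sF [::]).
  apply: IH => l u Uu; have := sF (rcons l i) u Uu.
  by rewrite /pdl -cats1 foldr_cat.
move=> l; have {cF} : ck_on (size l) U F by [].
(* [pdl] applies the last index of the list first, as [ck_on] peels off the innermost derivative;
   hence induction from the end of the list. *)
elim/last_ind: l F => [|l i IH] F; first by case.
by rewrite size_rcons => -[_ /(_ i) /IH h]; rewrite /pdl -cats1 foldr_cat.
Qed.

Lemma smooth_on_pd U F i : smooth_on U F -> smooth_on U (pd i F).
Proof. by move=> sF l; have := sF (rcons l i); rewrite /pdl -cats1 foldr_cat. Qed.

Lemma smooth_on_differentiable {U F} u : smooth_on U F -> U u -> differentiable F u.
Proof. by move=> sF; exact: (sF [::]). Qed.

Lemma near_open U u (P : 'rV[R]_n -> Prop) : open U -> U u ->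
  (forall v, U v -> P v) -> \forall v \near u, P v.
Proof.
by move=> oU Uu UP; apply: filterS UP _; exact: open_nbhs_nbhs.
Qed.

Lemma eq_ck_on k U F G : open U -> (forall u, U u -> F u = G u) ->
  ck_on k U F -> ck_on k U G.
Proof.
move=> oU; elim: k F G => [|k IH] F G FG [dF h].
- split=> // u Uu; have nFG := near_open U u (fun v => F v = G v) oU Uu FG.
  exact: (near_eq_differentiable _ _ _ nFG (dF u Uu)).
- split=> [u Uu|i].
    have nFG := near_open U u (fun v => F v = G v) oU Uu FG.
    exact: (near_eq_differentiable _ _ _ nFG (dF u Uu)).
  apply: IH (h i) => u Uu; apply: near_eq_derive.
  exact: near_open FG.
Qed.

Lemma is_derive_pd i F u : differentiable F u -> is_derive u (e i) F (pd i F u).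
Proof. by move=> dF; apply/derivableP; exact: diff_derivable. Qed.

Lemma ck_onW k U F : ck_on k.+1 U F -> ck_on k U F.
Proof.
by elim: k F => [|k IH] F [dF h]; split=> // i; apply: IH; exact: h.
Qed.

Lemma ck_onD k U F G : open U -> ck_on k U F -> ck_on k U G ->
  ck_on k U (fun u => F u + G u).
Proof.
move=> oU; elim: k F G => [|k IH] F G [dF hF] [dG hG].
  by split=> // u Uu; apply: differentiableD; [exact: dF|exact: dG].
split=> [u Uu|i]; first by apply: differentiableD; [exact: dF|exact: dG].
apply: eq_ck_on (IH _ _ (hF i) (hG i)) => // u Uu.
by rewrite /pd deriveD//; apply: diff_derivable; [exact: dF|exact: dG].
Qed.

Lemma ck_onM k U F G : open U -> ck_on k U F -> ck_on k U G ->
  ck_on k U (fun u => F u * G u).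
Proof.
move=> oU; elim: k F G => [|k IH] F G cF cG.
  by split=> // u Uu; apply: differentiableM; [exact: cF.1|exact: cG.1].
have [dF hF] := cF; have [dG hG] := cG.
split=> [u Uu|i]; first by apply: differentiableM; [exact: dF|exact: dG].
have := ck_onD _ _ _ _ oU (IH _ _ (ck_onW _ _ _ cF) (hG i)) (IH _ _ (ck_onW _ _ _ cG) (hF i)).
apply: eq_ck_on => // u Uu.
by rewrite /pd deriveM//; apply: diff_derivable; [exact: dF|exact: dG].
Qed.

Lemma pdV i F u : differentiable F u -> F u != 0 ->
  pd i (fun v => (F v)^-1) u = - pd i F u * ((F u)^-1 * (F u)^-1).
Proof.
move=> dF F0; rewrite /pd deriveV//; last exact: diff_derivable.
by rewrite /GRing.scale /=; field.
Qed.

Lemma ck_onN k U F : open U -> ck_on k U F -> ck_on k U (fun u => - F u).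
Proof.
move=> oU; elim: k F => [|k IH] F [dF hF].
  by split=> // u Uu; apply: differentiableN; exact: dF.
split=> [u Uu|i]; first by apply: differentiableN; exact: dF.
apply: eq_ck_on (IH _ (hF i)) => // u Uu.
by rewrite /pd deriveN//; apply: diff_derivable; exact: dF.
Qed.

(** The derivative of 1/F is -F_i (1/F)^2, so order k + 1 for 1/F needs only order k for 1/F. *)
Lemma ck_onV k U F : open U -> (forall u, U u -> F u != 0) -> ck_on k U F ->
  ck_on k U (fun u => (F u)^-1).
Proof.
move=> oU F0; elim: k => [|k IH] cF.
  by split=> // u Uu; apply: differentiableV; [exact: cF.1|exact: F0].
have [dF hF] := cF.
split=> [u Uu|i]; first by apply: differentiableV; [exact: dF|exact: F0].
have cV := IH (ck_onW _ _ _ cF).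
have := ck_onM _ _ _ _ oU (ck_onN _ _ _ oU (hF i)) (ck_onM _ _ _ _ oU cV cV).
apply: eq_ck_on => // u Uu.
by rewrite pdV//; [exact: dF|exact: F0].
Qed.

Lemma smooth_onM U F G : open U -> smooth_on U F -> smooth_on U G ->
  smooth_on U (fun u => F u * G u).
Proof.
by move=> oU /smooth_onP cF /smooth_onP cG; apply/smooth_onP => k; exact: ck_onM.
Qed.

Lemma smooth_onV U F : open U -> (forall u, U u -> F u != 0) -> smooth_on U F ->
  smooth_on U (fun u => (F u)^-1).
Proof.
by move=> oU F0 /smooth_onP cF; apply/smooth_onP => k; exact: ck_onV.
Qed.

(** With the sign frozen at its value at [u], the factor |f_i| of the volume density can be
    differentiated. *)
Lemma near_normr_sg F u : {for u, continuous F} -> F u != 0 ->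
  \forall v \near u, `|F v| = Num.sg (F u) * F v.
Proof.
move=> cF; case: (ltgtP (F u) 0) => // Fu _.
- have : \forall v \near u, F v < 0 by exact: (cvgr_lt _ cF).
  by apply: filterS => v Fv; rewrite ltr0_norm// ltr0_sg// mulN1r.
- have : \forall v \near u, 0 < F v by exact: (cvgr_gt _ cF).
  by apply: filterS => v Fv; rewrite gtr0_norm// gtr0_sg// mul1r.
Qed.

End Coordinates.

(** * Separation of the Schroedinger equation *)

Lemma ode_sol_exists {R : realType} (I : set R) (p q : R -> R) (x0 : R) :
  open I -> is_interval I -> I x0 ->
  (forall x, I x -> {for x, continuous p}) ->
  (forall x, I x -> {for x, continuous q}) ->
  exists phi, [/\ ode_sol I p q phi, phi x0 = 1 & derive1 phi x0 = 0].
Proof.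
move=> oI iI Ix0 cp cq.
have [y [z [y0 z0 dy dz]]] := linear_ode_exists I p q x0 oI iI Ix0 cp cq.
have yz x : I x -> derive1 y x = z x.
  by move=> Ix; rewrite derive1E; have [] := dy x Ix.
exists y; split => //; last by rewrite yz.
move=> x Ix.
(* The second derivative needs y' = z on a neighbourhood of [x], which openness of [I] provides. *)
have nyz : \forall t \near x, z t = derive1 y t.
  by apply: filterS (fun t It => esym (yz t It)) _; exact: open_nbhs_nbhs.
have [ddz vdz] := near_eq_is_derive nyz (dz x Ix).
split; first by have [] := dy x Ix.
split=> //; rewrite [derive1 (derive1 y) x]derive1E vdz yz//; ring.
Qed.

Section Separability.
Context {R : realType} {n : nat}.
Variables (U : set 'rV[R]_n) (g : 'I_n -> 'rV[R]_n -> R) (Rf : 'rV[R]_n -> R)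
  (f : 'I_n -> R -> R) (Gam : 'I_n -> 'rV[R]_n -> R) (P : 'rV[R]_n -> R).
Hypotheses (oU : open U) (sR : smooth_on U Rf) (R0 : forall u, U u -> Rf u != 0)
  (sf : forall i, smooth_on U (fun u => f i (ucoord i u)))
  (f0 : forall i u, U u -> f i (ucoord i u) != 0)
  (dGam : forall i u, U u -> is_derive u (delta_mx 0 i : 'rV[R]_n) (Gam i) 0)
  (P0 : forall u, U u -> P u != 0).

Local Notation e i := (delta_mx 0 i : 'rV[R]_n).
Let fprod (u : 'rV[R]_n) := \prod_(i < n) `|f i (ucoord i u)|.
Let S (u : 'rV[R]_n) := (Rf u)^-1.

(** The metric enters the computation only through these two identities; [Gam i] plays the part of P
    / B_i. *)
Hypotheses
  (hdetE : forall u, U u -> hdet g u = conf_factor Rf u * Rf u ^- 2 * P u / fprod u)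
  (fluxE : forall i u, U u -> hdet g u / Hcoef g i u ^+ 2 =
     Rf u ^- 2 * (Gam i u * f i (ucoord i u) ^+ 2 / fprod u)).

Let sS : smooth_on U S. Proof. exact: smooth_onV. Qed.

Let df i u : U u -> derivable (f i) (ucoord i u) 1.
Proof.
move=> Uu; rewrite -derivable_ucoord; apply: diff_derivable.
exact: smooth_on_differentiable (sf i) Uu.
Qed.

Lemma prod_ucoord_line (F : 'I_n -> R -> R) i (h : R) (u : 'rV[R]_n) :
  \prod_(j < n | j != i) F j (ucoord j (h *: e i + u)) =
  \prod_(j < n | j != i) F j (ucoord j u).
Proof.
by apply: eq_bigr => j ji; rewrite ucoord_line (negbTE ji) add0r.
Qed.

Section Flux.
Variable phi : 'I_n -> R -> R.
Hypotheses
  (d1 : forall i x, coord_range U i x -> derivable (phi i) x 1)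
  (d2 : forall i x, coord_range U i x -> derivable (derive1 (phi i)) x 1).
Let psi (u : 'rV[R]_n) := Rf u * \prod_(i < n) phi i (ucoord i u).
Let phi_off i (u : 'rV[R]_n) := \prod_(j < n | j != i) phi j (ucoord j u).

Let rangeP i u : U u -> coord_range U i (ucoord i u).
Proof. by move=> Uu; exists u. Qed.

(** Uses R^-2 d_i R = -d_i S, and that the factors other than [phi i] do not depend on u^i. *)
Lemma flux_separated i u : U u ->
  Rf u ^- 2 * pd i psi u =
  phi_off i u * (S u * derive1 (phi i) (ucoord i u) - pd i S u * phi i (ucoord i u)).
Proof.
move=> Uu.
have dR := is_derive_pd i Rf u (smooth_on_differentiable u sR Uu).
have dphi := is_derive_ucoord i (phi i) u (d1 _ _ (rangeP i _ Uu)).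
have doff : is_derive u (e i) (phi_off i) 0.
  by apply: is_derive_line_const => h; exact: prod_ucoord_line.
have dpsi := is_deriveM dR (is_deriveM dphi doff).
have -> : pd i psi u = Rf u * (phi_off i u * derive1 (phi i) (ucoord i u)) +
    phi i (ucoord i u) * phi_off i u * pd i Rf u.
  have -> : psi = Rf * ((fun v => phi i (ucoord i v)) * phi_off i).
    by apply/funext => v; rewrite /psi (bigD1 i).
  by rewrite /pd derive_val; rewrite /GRing.scale /= mulr0 add0r.
rewrite pdV//; last exact: R0; last exact: smooth_on_differentiable sR Uu.
by rewrite /S; field; exact: R0.
Qed.

Lemma pd_flux i u : U u ->
  pd i (fun v => hdet g v / Hcoef g i v ^+ 2 * pd i psi v) u =
  (fprod u)^-1 * (Gam i u * f i (ucoord i u) ^+ 2 *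
    (phi_off i u * S u * (derive1 (derive1 (phi i)) (ucoord i u)
       + derive1 (f i) (ucoord i u) / f i (ucoord i u) * derive1 (phi i) (ucoord i u))
     - \prod_(j < n) phi j (ucoord j u) * (pd i (pd i S) u
       + derive1 (f i) (ucoord i u) / f i (ucoord i u) * pd i S u))).
Proof.
move=> Uu.
pose f_off v := \prod_(j < n | j != i) `|f j (ucoord j v)|.
have f_off0 v : U v -> f_off v != 0.
  by move=> Uv; apply/prodf_neq0 => j _; rewrite normr_eq0; exact: f0.
(* The part of the flux with zero i-th derivative. Since f_i^2 / |f_i| = |f_i|, which is [sg] times
   f_i near [u], the flux is locally sg f_i D W. *)
pose D v := Gam i v * ((f_off v)^-1 * phi_off i v).
pose sg := Num.sg (f i (ucoord i u)).
pose W v := S v * derive1 (phi i) (ucoord i v) - pd i S v * phi i (ucoord i v).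
have near_flux : \forall v \near u,
    sg * (f i (ucoord i v) * (D v * W v)) =
    hdet g v / Hcoef g i v ^+ 2 * pd i psi v.
  have cf : {for u, continuous (fun v => f i (ucoord i v))}.
    exact/differentiable_continuous/(smooth_on_differentiable u (sf i) Uu).
  have := near_normr_sg _ _ cf (f0 i u Uu).
  have : \forall v \near u, U v by exact: open_nbhs_nbhs.
  apply: filterS2 => v Uv fv.
  have fiv := f0 i v Uv; have fov := f_off0 v Uv.
  have FE : fprod v = `|f i (ucoord i v)| * f_off v by rewrite /fprod (bigD1 i).
  rewrite fluxE// [RHS]mulrAC flux_separated// -/(W v) FE [LHS]mulrA /sg -fv.
  have nf : `|f i (ucoord i v)| != 0 by rewrite normr_eq0.
  rewrite -[f i (ucoord i v) ^+ 2]real_normK ?num_real// /D.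
  by field; rewrite nf fov.
have dS := is_derive_pd i S u (smooth_on_differentiable u sS Uu).
have ddS := is_derive_pd i _ u (smooth_on_differentiable u (smooth_on_pd _ _ i sS) Uu).
have dphi := is_derive_ucoord i (phi i) u (d1 _ _ (rangeP i _ Uu)).
have ddphi := is_derive_ucoord i (derive1 (phi i)) u (d2 _ _ (rangeP i _ Uu)).
have dfi := is_derive_ucoord i (f i) u (df i u Uu).
have dconst : is_derive u (e i) (fun v => (f_off v)^-1 * phi_off i v) 0.
  apply: is_derive_line_const => h.
  by rewrite /f_off /phi_off prod_ucoord_line (prod_ucoord_line (fun j x => `|f j x|)).
have dD : is_derive u (e i) D 0.
  have := is_deriveM (dGam i u Uu) dconst.
  by rewrite /GRing.scale /= !mulr0 addr0.
(* The two cross terms d_i S phi_i' cancel in this derivative, leaving S phi_i'' - phi_i d_ii S. *)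
have dW := is_deriveB (is_deriveM dS ddphi) (is_deriveM ddS dphi).
have dflux := is_deriveM dfi (is_deriveM dD dW).
have dall := near_eq_is_derive near_flux (is_deriveZ sg dflux).
rewrite [LHS](@derive_val _ _ _ _ _ _ _ dall).
have fi := f0 i u Uu; have fo := f_off0 u Uu.
have nf : `|f i (ucoord i u)| != 0 by rewrite normr_eq0.
have FE : fprod u = `|f i (ucoord i u)| * f_off u by rewrite /fprod (bigD1 i).
have -> : \prod_(j < n) phi j (ucoord j u) = phi i (ucoord i u) * phi_off i u.
  by rewrite (bigD1 i).
rewrite FE /GRing.scale /= !fctE /= -/(pd i (pd i S)) /D.
have sgE : sg * f i (ucoord i u) = `|f i (ucoord i u)| by rewrite normrEsg.
have -> : sg = `|f i (ucoord i u)| / f i (ucoord i u) by rewrite -sgE mulfK.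
have f2 : f i (ucoord i u) ^+ 2 = `|f i (ucoord i u)| ^+ 2.
  by rewrite real_normK ?num_real.
rewrite f2; move: (f i _) (f_off u) fi fo nf => a b a0 b0 na0.
by field; rewrite a0 b0 na0.
Qed.

(** The 1/F common to all flux terms cancels against the one in h. The remaining prefactor is
    nonzero on [U], so the equation says that the second factor vanishes. *)
Lemma schroedinger_separated (w : R) u : U u ->
  laplacian g psi u + w * psi u =
  (conf_factor Rf u * Rf u ^- 2 * P u)^-1 *
  (\sum_(i < n) Gam i u * f i (ucoord i u) ^+ 2 *
    (phi_off i u * S u * (derive1 (derive1 (phi i)) (ucoord i u)
       + derive1 (f i) (ucoord i u) / f i (ucoord i u) * derive1 (phi i) (ucoord i u))
     - \prod_(j < n) phi j (ucoord j u) * (pd i (pd i S) u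
       + derive1 (f i) (ucoord i u) / f i (ucoord i u) * pd i S u))
   + conf_factor Rf u / Rf u * P u * w * \prod_(j < n) phi j (ucoord j u)).
Proof.
move=> Uu; rewrite /laplacian (eq_bigr _ (fun i _ => pd_flux i u Uu)).
rewrite -mulr_sumr mulrA hdetE//.
have Fu : fprod u != 0.
  by apply/prodf_neq0 => j _; rewrite normr_eq0; exact: f0.
have cu : conf_factor Rf u != 0.
  by rewrite /conf_factor gt_eqF// powR_gt0// normr_gt0; exact: R0.
have Ru := R0 u Uu; have Pu := P0 u Uu.
by rewrite /psi; field; rewrite Fu cu Ru Pu.
Qed.

End Flux.

Hypothesis cU : connected U.

Lemma R_separable_iff (V : 'rV[R]_n -> R) (k : R) :
  R_separable U g V k Rf <->
  exists q : 'I_n -> R -> R,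
    (forall i, smooth_on U (fun u => q i (ucoord i u))) /\
    forall u, U u ->
      \sum_(i < n) Gam i u * f i (ucoord i u) ^+ 2 * bracket Rf f q i u
      = conf_factor Rf u / Rf u * P u * (k ^+ 2 - V u).
Proof.
have K0 u : U u -> (conf_factor Rf u * Rf u ^- 2 * P u)^-1 != 0.
  move=> Uu; rewrite invr_eq0 !mulf_neq0//; last exact: P0.
    by rewrite /conf_factor gt_eqF// powR_gt0// normr_gt0; exact: R0.
  by rewrite invr_eq0 expf_neq0//; exact: R0.
have range i u : U u -> coord_range U i (ucoord i u) by move=> Uu; exists u.
split=> [[p [q [sp [sq sep]]]]|[q [sq eqn]]].
- exists q; split=> // u Uu.
  have cont (r : 'I_n -> R -> R) i : smooth_on U (fun u => r i (ucoord i u)) ->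
      forall x, coord_range U i x -> {for x, continuous (r i)}.
    move=> sr _ [v Uv <-]; apply/differentiable_continuous/derivable1_diffP.
    rewrite -derivable_ucoord; apply: diff_derivable.
    exact: smooth_on_differentiable sr Uv.
  (* These solutions are chosen for the given point [u]; [q] was fixed before it. *)
  have /choice[phi hphi] : forall i, exists phi,
      [/\ ode_sol (coord_range U i) (p i) (q i) phi, phi (ucoord i u) = 1 &
         derive1 phi (ucoord i u) = 0].
    move=> i; apply: ode_sol_exists.
    + exact: coord_range_open.
    + exact: coord_range_interval.
    + exact: range.
    + exact: cont (sp i).
    + exact: cont (sq i).
  have sol i : ode_sol (coord_range U i) (p i) (q i) (phi i) by have [] := hphi i.
  have phi1 i : phi i (ucoord i u) = 1 by have [] := hphi i.
  have dphi0 i : derive1 (phi i) (ucoord i u) = 0 by have [] := hphi i.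
  (* Value 1 and slope 0 leave phi_i'' = -q_i at the point, whatever [p] is. *)
  have ddphi i : derive1 (derive1 (phi i)) (ucoord i u) = - q i (ucoord i u).
    have [_ [_ ]] := sol i _ (range i u Uu).
    by rewrite dphi0 phi1 mulr0 mulr1 addr0 => /eqP; rewrite addr_eq0 => /eqP.
  have := sep phi sol u Uu => /=.
  rewrite schroedinger_separated//; last 2 first.
    + by move=> i x /(sol i)[].
    + by move=> i x /(sol i)[_ []].
  move=> /eqP; rewrite mulf_eq0 (negbTE (K0 u Uu)) /= => /eqP.
  have prod1 : \prod_(j < n) phi j (ucoord j u) = 1 by apply: big1.
  have off1 i : \prod_(j < n | j != i) phi j (ucoord j u) = 1 by apply: big1.
  rewrite prod1 mulr1.
  move/eqP; rewrite addrC addr_eq0 => /eqP ->; rewrite -sumrN.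
  apply: eq_bigr => i _; rewrite dphi0 ddphi off1.
  by rewrite /bracket -/S -[(Rf u)^-1]/(S u); ring.
(* With this [p], the separated equations replace phi_i'' + (f_i'/f_i) phi_i' by -q_i phi_i, which
   supplies the last term of [bracket]. *)
- exists (fun i x => derive1 (f i) x / f i x), q; split; last split=> //.
    move=> i; apply: smooth_onM => //; last by apply: smooth_onV => //; exact: f0.
    have -> : (fun u => derive1 (f i) (ucoord i u)) = pd i (fun u => f i (ucoord i u)).
      by apply/funext => u; rewrite pd_ucoord.
    exact: smooth_on_pd.
  move=> phi sol psi u Uu.
  rewrite /psi schroedinger_separated//; last 2 first.
    + by move=> i x /(sol i)[].
    + by move=> i x /(sol i)[_ []].
  apply/eqP; rewrite mulf_eq0; apply/orP; right; apply/eqP.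
  rewrite -(eqn u Uu) mulr_suml -big_split /= big1// => i _.
  have [_ [_ ode]] := sol i _ (range i u Uu).
  have -> : derive1 (derive1 (phi i)) (ucoord i u) +
      derive1 (f i) (ucoord i u) / f i (ucoord i u) * derive1 (phi i) (ucoord i u) =
      - (q i (ucoord i u) * phi i (ucoord i u)).
    by apply/eqP; rewrite -addr_eq0; apply/eqP.
  by rewrite [in X in _ - X](bigD1 i)//= [in X in _ + X](bigD1 i)//= /bracket -/S -[(Rf u)^-1]/(S u); ring.
Qed.

End Separability.

(** * Volume density and fluxes of the metric form common to (A) and (B) *)

Lemma natr_sub2_neq0 {R : realType} (m : nat) : (3 <= m)%N -> (m%:R - 2 : R) != 0.
Proof. by rewrite subr_eq0 eqr_nat; case: m => [|[|[|]]]. Qed.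

Lemma sqrtr_powR {R : realType} (a x : R) : Num.sqrt (a `^ x) = a `^ (x / 2).
Proof.
have -> : a `^ x = (a `^ (x / 2)) ^+ 2.
  by rewrite -powR_mulrn ?powR_ge0// -powRrM divfK.
by rewrite sqrtr_sqr ger0_norm// powR_ge0.
Qed.

(** Exponent count for n-th powers of square roots in h, used with y = -2 for the conformal factor
    and y = 1 for the product of the G_(j). *)
Lemma sqrtr_powR_exp {R : realType} (a x y : R) (m : nat) : 0 < a ->
  x / 2 * m%:R = x + y -> Num.sqrt (a `^ x) ^+ m = a `^ x * a `^ y.
Proof.
move=> a0 xy; rewrite sqrtr_powR -powR_mulrn ?powR_ge0// -powRrM xy powRD//.
by rewrite (gt_eqF a0) implybT.
Qed.

Section DiagonalMetric.
Context {R : realType} {n : nat}.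
Variables (U : set 'rV[R]_n) (Rf : 'rV[R]_n -> R) (f : 'I_n -> R -> R)
  (g B Gam : 'I_n -> 'rV[R]_n -> R) (P : 'rV[R]_n -> R).
Hypotheses (n3 : (3 <= n)%N) (oU : open U) (cU : connected U)
  (sR : smooth_on U Rf) (R0 : forall u, U u -> Rf u != 0)
  (sf : forall i, smooth_on U (fun u => f i (ucoord i u)))
  (f0 : forall i u, U u -> f i (ucoord i u) != 0)
  (dGam : forall i u, U u -> is_derive u (delta_mx 0 i : 'rV[R]_n) (Gam i) 0)
  (B0 : forall i u, U u -> 0 < B i u)
  (gE : forall i u, U u -> g i u = conf_factor Rf u * B i u / f i (ucoord i u) ^+ 2)
  (PE : forall u, U u -> \prod_(i < n) Num.sqrt (B i u) = P u)
  (GamE : forall i u, U u -> Gam i u = P u / B i u).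

Let cf0 u : U u -> 0 < conf_factor Rf u.
Proof. by move=> Uu; rewrite powR_gt0 ?normr_gt0// R0. Qed.

Let f2_gt0 i u : U u -> 0 < f i (ucoord i u) ^+ 2.
Proof. by move=> Uu; rewrite exprn_even_gt0 //= f0. Qed.

Lemma sqrt_conf_factor u : U u ->
  Num.sqrt (conf_factor Rf u) ^+ n = conf_factor Rf u * Rf u ^- 2.
Proof.
(* The -2 comes from (n/2) * 4/(2-n) = 4/(2-n) - 2. *)
move=> Uu; rewrite (@sqrtr_powR_exp _ _ _ (- 2)); last 2 first.
- by rewrite normr_gt0 R0.
- by field; rewrite -opprB oppr_eq0 natr_sub2_neq0.
- by rewrite powRN powR_mulrn// real_normK ?num_real.
Qed.

Lemma hdet_diagonal u : U u ->
  hdet g u = conf_factor Rf u * Rf u ^- 2 * P u / \prod_(i < n) `|f i (ucoord i u)|.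
Proof.
move=> Uu; rewrite -sqrt_conf_factor// -PE// /hdet /Hcoef.
rewrite -[in X in _ ^+ X](card_ord n) -prodr_const -big_split /= -prodf_div.
apply: eq_bigr => i _; rewrite gE// sqrtrM ?mulr_ge0 ?ltW ?cf0 ?B0//.
by rewrite sqrtrM ?ltW ?cf0// sqrtrV ?sqr_ge0// sqrtr_sqr.
Qed.

Lemma flux_diagonal i u : U u -> hdet g u / Hcoef g i u ^+ 2 =
  Rf u ^- 2 * (Gam i u * f i (ucoord i u) ^+ 2 / \prod_(i < n) `|f i (ucoord i u)|).
Proof.
move=> Uu; rewrite hdet_diagonal// /Hcoef sqr_sqrtr; last first.
  by rewrite gE// divr_ge0 ?sqr_ge0// mulr_ge0 ?ltW ?cf0 ?B0.
have F0 : \prod_(i < n) `|f i (ucoord i u)| != 0.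
  by apply/prodf_neq0 => j _; rewrite normr_eq0 f0.
rewrite gE// GamE//; field.
by rewrite F0 R0// f0// !gt_eqF ?B0 ?cf0.
Qed.

Lemma R_separable_diagonal (V : 'rV[R]_n -> R) (k : R) :
  R_separable U g V k Rf <->
  exists q : 'I_n -> R -> R,
    (forall i, smooth_on U (fun u => q i (ucoord i u))) /\
    forall u, U u ->
      \sum_(i < n) Gam i u * f i (ucoord i u) ^+ 2 * bracket Rf f q i u
      = conf_factor Rf u / Rf u * P u * (k ^+ 2 - V u).
Proof.
apply: R_separable_iff => //.
- move=> u Uu; rewrite -PE//; apply/prodf_neq0 => i _.
  by rewrite gt_eqF// sqrtr_gt0 B0.
- exact: hdet_diagonal.
- exact: flux_diagonal.
Qed.

End DiagonalMetric.

(** * Products of the functions G in (A) and (B) *)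

Lemma Gprod_powR {R : realType} {n : nat} (G : 'I_n -> 'rV[R]_n -> R) u :
  Gprod G u = (\prod_(j < n) `|G j u|) `^ (2 / (n%:R - 2)).
Proof.
(* Nonnegativity is carried through the induction because [powRM] requires it. *)
pose K (x y : R) := 0 <= y /\ x = y `^ (2 / (n%:R - 2)).
suff : K (Gprod G u) (\prod_(j < n) `|G j u|) by case.
apply: big_ind2 => [|x1 x2 y1 y2 [x0 ->] [y0 ->]|j _]; rewrite /K.
- by rewrite powR1.
- by rewrite mulr_ge0// powRM.
- by [].
Qed.

Section PairProducts.
Context {R : realType} {n : nat}.
Variable G : 'I_n -> 'I_n -> R -> R -> R.
Implicit Types (i j : 'I_n) (u : 'rV[R]_n).

(** The |G_ij| extended symmetrically, and by 1 on the diagonal, so that products over i < j become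
    products over full rows and columns. *)
Definition pair_norm i j u : R :=
  if (i < j)%N then `|G i j (ucoord i u) (ucoord j u)|
  else if (j < i)%N then `|G j i (ucoord j u) (ucoord i u)| else 1.

Lemma pair_normC i j u : pair_norm i j u = pair_norm j i u.
Proof. by rewrite /pair_norm; case: ltngtP. Qed.

Lemma pair_norm_diag i u : pair_norm i i u = 1.
Proof. by rewrite /pair_norm ltnn. Qed.

Lemma Gpair_pair_norm i u : Gpair G i u = (\prod_(j < n) pair_norm i j u) ^+ 2.
Proof.
rewrite /Gpair [X in X * _]big_mkcond [X in _ * X]big_mkcond -big_split /= -prodrXl.
apply: eq_bigr => j _; rewrite /pair_norm.
by case: ltngtP => _; rewrite ?mul1r ?mulr1 ?expr1n// real_normK ?num_real.
Qed.

(** Row i and column i of the symmetric array have equal products, together the square [Gpair G i].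
    The entries left over do not involve u^i, so P / B_i is independent of u^i in (B). *)
Lemma pair_norm_prod_split i u :
  \prod_(a < n) \prod_(b < n) pair_norm a b u =
  Gpair G i u * \prod_(a < n | a != i) \prod_(b < n | b != i) pair_norm a b u.
Proof.
rewrite Gpair_pair_norm (bigD1 i)//= expr2 -mulrA; congr (_ * _).
under eq_bigr do rewrite (bigD1 i)//=.
rewrite big_split /=; congr (_ * _).
rewrite [RHS](bigD1 i)//= pair_norm_diag mul1r.
by apply: eq_bigr => a _; exact: pair_normC.
Qed.

Lemma pair_norm_gt0 i j u :
  (forall a b : 'I_n, (a < b)%N -> G a b (ucoord a u) (ucoord b u) != 0) ->
  0 < pair_norm i j u.
Proof.
by move=> G0; rewrite /pair_norm; case: ltngtP => // ?; rewrite normr_gt0 G0.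
Qed.

Lemma pair_norm_line i a b (h : R) u : a != i -> b != i ->
  pair_norm a b (h *: (delta_mx 0 i : 'rV[R]_n) + u) = pair_norm a b u.
Proof.
by move=> ai bi; rewrite /pair_norm !ucoord_line (negbTE ai) (negbTE bi) !add0r.
Qed.

End PairProducts.

Theorem theorem4 (R : realType) (n : nat) (hn : (3 <= n)%N)
  (U : set 'rV[R]_n) (hUo : open U) (hUc : connected U)
  (k : R) (V : 'rV[R]_n -> R) (Rf : 'rV[R]_n -> R) (f : 'I_n -> R -> R)
  (hV : smooth_on U V) (hR : smooth_on U Rf)
  (hR0 : forall u, U u -> Rf u != 0)
  (hf : forall i, smooth_on U (fun u => f i (ucoord i u)))
  (hf0 : forall i u, U u -> f i (ucoord i u) != 0) :
  (forall G : 'I_n -> 'rV[R]_n -> R,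
     (forall i, smooth_on U (G i)) ->
     (forall i u, U u -> G i u != 0) ->
     (forall i u, U u -> pd i (G i) u = 0) ->
     (R_separable U (metricA Rf G f) V k Rf <->
      exists q : 'I_n -> R -> R,
        (forall i, smooth_on U (fun u => q i (ucoord i u))) /\
        forall u, U u ->
          \sum_(i < n) (G i u) ^+ 2 * (f i (ucoord i u)) ^+ 2 * bracket Rf f q i u
          = conf_factor Rf u / Rf u * Gprod G u * (k ^+ 2 - V u)))
  /\
  (forall G : 'I_n -> 'I_n -> R -> R -> R,
     (forall i j : 'I_n, (i < j)%N ->
        smooth_on U (fun u => G i j (ucoord i u) (ucoord j u))) ->
     (forall (i j : 'I_n) u, (i < j)%N -> U u ->
        G i j (ucoord i u) (ucoord j u) != 0) ->
     (R_separable U (metricB Rf G f) V k Rf <->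
      exists q : 'I_n -> R -> R,
        (forall i, smooth_on U (fun u => q i (ucoord i u))) /\
        forall u, U u ->
          \sum_(i < n) (f i (ucoord i u)) ^+ 2 / Gpair G i u * bracket Rf f q i u
          = conf_factor Rf u / Rf u * (k ^+ 2 - V u))).
Proof.
split=> G.
- move=> sG G0 dG.
  have X0 u : U u -> 0 < \prod_(j < n) `|G j u|.
    by move=> Uu; apply: prodr_gt0 => j _; rewrite normr_gt0 G0.
  (* For (A), P is [Gprod G] and B_i = P / G_(i)^2, hence P / B_i = G_(i)^2. *)
  apply: (@R_separable_diagonal _ _ U Rf f _
    (fun i u => Gprod G u * G i u ^- 2) (fun i u => G i u ^+ 2)) => //.
  + move=> i u Uu.
    have dGi : is_derive u (delta_mx 0 i : 'rV[R]_n) (G i) 0.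
      by rewrite -(dG i u Uu); exact/is_derive_pd/(smooth_on_differentiable u (sG i)).
    by have := is_deriveM dGi dGi; rewrite /GRing.scale /= !mulr0 addr0.
  + move=> i u Uu; rewrite mulr_gt0 ?invr_gt0 ?exprn_even_gt0 //= ?G0//.
    by apply: prodr_gt0 => j _; rewrite powR_gt0 ?normr_gt0 ?G0.
  + by move=> i u Uu; rewrite /metricA !mulrA.
  + move=> u Uu; rewrite Gprod_powR.
    under eq_bigr do rewrite sqrtrM ?powR_ge0// sqrtrV ?sqr_ge0// sqrtr_sqr.
    rewrite prodf_div prodr_const card_ord.
    (* Here (n/2) * 2/(n-2) = 2/(n-2) + 1; the extra first power of the product of the |G_(j)|
       cancels the denominator. *)
    rewrite (@sqrtr_powR_exp _ _ _ 1) ?X0//.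
      by rewrite powRr1 ?ltW ?X0// mulfK// gt_eqF ?X0.
    by field; exact: natr_sub2_neq0.
  + move=> i u Uu; field; rewrite G0//= gt_eqF//.
    by apply: prodr_gt0 => j _; rewrite powR_gt0 ?normr_gt0 ?G0.
- move=> sG G0.
  have s0 i j u : U u -> 0 < pair_norm G i j u.
    by move=> Uu; apply: pair_norm_gt0 => a b ab; exact: G0.
  have B0 i u : U u -> 0 < Gpair G i u.
    move=> Uu; rewrite Gpair_pair_norm exprn_even_gt0//= gt_eqF//.
    by apply: prodr_gt0 => j _; exact: s0.
  (* Each unordered pair is counted twice, so [P] is the product of G_ij^2 over i < j; [Gam i] omits
     the i-th row and column. *)
  pose P (u : 'rV[R]_n) := \prod_(a < n) \prod_(b < n) pair_norm G a b u.
  pose Gam (i : 'I_n) (u : 'rV[R]_n) :=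
    \prod_(a < n | a != i) \prod_(b < n | b != i) pair_norm G a b u.
  have P0 u : U u -> P u != 0.
    move=> Uu; rewrite gt_eqF//; apply: prodr_gt0 => a _.
    by apply: prodr_gt0 => b _; exact: s0.
  have GamE i u : U u -> Gam i u = P u / Gpair G i u.
    move=> Uu; rewrite /P (pair_norm_prod_split _ i) -/(Gam i u).
    by rewrite mulrAC divff ?mul1r// gt_eqF ?B0.
  have sepE : R_separable U (metricB Rf G f) V k Rf <->
      exists q : 'I_n -> R -> R,
      (forall i, smooth_on U (fun u => q i (ucoord i u))) /\
      forall u, U u ->
        \sum_(i < n) Gam i u * f i (ucoord i u) ^+ 2 * bracket Rf f q i u
        = conf_factor Rf u / Rf u * P u * (k ^+ 2 - V u).
    apply: (@R_separable_diagonal _ _ U Rf f _ (Gpair G)) => //.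
    + move=> i u Uu; apply: is_derive_line_const => h.
      apply: eq_bigr => a ai; apply: eq_bigr => b bi.
      exact: pair_norm_line.
    + move=> u Uu; apply: eq_bigr => a _.
      rewrite Gpair_pair_norm sqrtr_sqr ger0_norm//.
      by apply: prodr_ge0 => b _; rewrite ltW// s0.
  (* Dividing by the nonzero [P] turns the general condition into that of (B), with the same [q]. *)
  have eqnE (q : 'I_n -> R -> R) u : U u ->
      (\sum_(i < n) Gam i u * f i (ucoord i u) ^+ 2 * bracket Rf f q i u
        = conf_factor Rf u / Rf u * P u * (k ^+ 2 - V u)) <->
      (\sum_(i < n) f i (ucoord i u) ^+ 2 / Gpair G i u * bracket Rf f q i u
        = conf_factor Rf u / Rf u * (k ^+ 2 - V u)).
    move=> Uu.
    have -> : \sum_(i < n) Gam i u * f i (ucoord i u) ^+ 2 * bracket Rf f q i u =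
        P u * \sum_(i < n) f i (ucoord i u) ^+ 2 / Gpair G i u * bracket Rf f q i u.
      rewrite mulr_sumr; apply: eq_bigr => i _; rewrite GamE//; ring.
    have -> : conf_factor Rf u / Rf u * P u * (k ^+ 2 - V u) =
        P u * (conf_factor Rf u / Rf u * (k ^+ 2 - V u)) by ring.
    by split=> [/(mulfI (P0 u Uu))|->].
  by split=> [/sepE|] [q [sq eqn]]; [|apply/sepE]; exists q; split=> // u Uu;
    apply/(eqnE q u Uu); exact: eqn.
Qed.
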